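(* Complex conjugation is weakly nonphysical in the theory $\mathsf T$ defined in the context. Explicitly: let a closed circuit be assembled from a state $\rho$ of $\mathsf T$, operations $\Lambda_1,\dots,\Lambda_n\in\mathcal O$ and a measurement $\{E_k\}\subset\mathcal E$ with $\sum_kE_k=\mathbb I$, and let partial conjugations $\Gamma_S$ be inserted at arbitrary points of the circuit and on arbitrary subsets $S$ of the wires present there. Then the resulting numbers $$p(k)=\operatorname{Tr}\bigl[E_k\,(\mathcal M_m\circ\cdots\circ\mathcal M_1)(\rho)\bigr],$$ where $\mathcal M_1,\dots,\mathcal M_m$ is the resulting sequence of maps (each one either an operation in $\mathcal O$ or some $\Gamma_S$), lie in $[0,1]$ and satisfy $\sum_kp(k)=1$.
   Context: A wire carries a finite-dimensional complex Hilbert space with a fixed orthonormal basis; a system is a finite list of wires composed by the tensor product. $\Gamma_S$ is partial transposition in the fixed bases on the wires in $S$; it is the partial action of complex conjugation (which acts on Hermitian operators as transposition) on those wires. A linear map $\Lambda:\mathcal L(\mathcal H_{\rm in})\to\mathcal L(\mathcal H_{\rm out})$ has its input and output wires labelled by a common index set, each label on at most one input and at most one output wire; $\Gamma_V\circ\Lambda\circ\Gamma_V$ transposes the input wires with label in $V$, applies $\Lambda$, and transposes the output wires with label in $V$. Labels are consistent under composition. The theory $\mathsf T$: states are all density matrices; effects are $\mathcal E=\{E\text{ Hermitian}:0\le\Gamma_S(E)\le\mathbb I\ \forall S\}$; operations $\mathcal O$ are the trace-preserving maps $\Lambda$ with $\Gamma_V\circ\Lambda\circ\Gamma_V$ completely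 positive for every set $V$ of labels (an operation may act as the identity on some of the wires present). A symmetry of a theory is physical if each of its transformations is an operation of the theory (so acts admissibly also on part of a composite); it is weakly nonphysical if it is not physical but inserting its transformations (on arbitrary wires) into closed circuits of the theory never returns a number outside $[0,1]$ where a probability is expected. *)

(* Defs.v *)
From mathcomp Require Import all_boot all_order all_algebra.
From mathcomp Require Import complex reals.

Set Implicit Arguments.
Unset Strict Implicit.
Unset Printing Implicit Defensive.

Import Order.TTheory GRing.Theory Num.Theory.

Local Open Scope ring_scope.
Local Open Scope sesquilinear_scope.

Record wire := Wire { label : nat; dim : nat; dim_gt0 : (0 < dim)%N }.

Definition system := seq wire.

(* A set of labels selects a set of wires faithfully only on such systems. *)
Definition well_labelled (s : system) : bool := uniq (map label s).

(* Index set of the fixed product basis. It is defined by recursion so that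
   basis (r ++ s) decomposes without casts (see pair_index, split_index). *)
Fixpoint basis (s : system) : finType :=
  if s is w :: s' then ('I_(dim w) * basis s')%type else unit.

Fixpoint pair_index (r s : system) : basis r -> basis s -> basis (r ++ s) :=
  match r return basis r -> basis s -> basis (r ++ s) with
  | [::] => fun _ y => y
  | _ :: _ => fun x y => (x.1, pair_index x.2 y)
  end.

Fixpoint split_index (r s : system) : basis (r ++ s) -> basis r * basis s :=
  match r return basis (r ++ s) -> basis r * basis s with
  | [::] => fun z => (tt, z)
  | _ :: _ => fun z =>
      let xy := split_index z.2 in ((z.1, xy.1), xy.2)
  end.

(* Coordinates from y on the wires with label in S, from x elsewhere. *)
Fixpoint mix_index (S : {pred nat}) (s : system) :
    basis s -> basis s -> basis s :=
  match s return basis s -> basis s -> basis s with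
  | [::] => fun x _ => x
  | w :: _ => fun x y =>
      (if label w \in S then y.1 else x.1, mix_index S x.2 y.2)
  end.

Section Operators.
Variable C : numClosedFieldType.

Definition operator (s : system) := 'M[C]_#|basis s|.

Definition entry s (X : operator s) (x y : basis s) : C :=
  X (enum_rank x) (enum_rank y).

Definition operator_of s (f : basis s -> basis s -> C) : operator s :=
  \matrix_(i, j) f (enum_val i) (enum_val j).

(* Positive semidefinite; for a complex matrix this implies Hermitian. *)
Definition psdmx n (A : 'M[C]_n) : Prop :=
  forall v : 'cV[C]_n, 0 <= (v ^t* *m A *m v) 0 0.

Definition partial_transpose (S : {pred nat}) s (X : operator s) : operator s :=
  operator_of (fun x y => entry X (mix_index S x y) (mix_index S y x)).

(* The map id_r (x) L, which applies L to each block <x| X |x'>, for x and x'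
   in the basis of r. *)
Definition extend r s t (L : operator s -> operator t)
    (X : operator (r ++ s)) : operator (r ++ t) :=
  operator_of (fun z z' =>
    let x := (split_index z).1 in let x' := (split_index z').1 in
    let block := operator_of
      (fun y y' => entry X (pair_index x y) (pair_index x' y')) in
    entry (L block) (split_index z).2 (split_index z').2).

Definition completely_positive s t (L : operator s -> operator t) : Prop :=
  forall (r : system) (X : operator (r ++ s)),
    psdmx X -> psdmx (extend L X).

Definition trace_preserving s t (L : operator s -> operator t) : Prop :=
  forall X : operator s, \tr (L X) = \tr X.

Record theory := Theory {
  is_state : forall s, operator s -> Prop;
  is_effect : forall s, operator s -> Prop;
  is_operation : forall s t, (operator s -> operator t) -> Prop }.

(* G s f says that f is one of the transformations of the symmetry, acting on
   some of the wires of the composite s. *)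
Definition symmetry := forall s : system, (operator s -> operator s) -> Prop.

Definition physical (T : theory) (G : symmetry) : Prop :=
  forall s f, well_labelled s -> G s f -> is_operation T f.

Definition is_measurement (T : theory) s (K : finType) (E : K -> operator s) :=
  (forall k, is_effect T (E k)) /\ \sum_k E k = 1%:M.

(* The composites M_m \o ... \o M_1 in which every M_i is either an operation
   of T, applied next to arbitrary spectator wires r (possibly none), or an
   inserted transformation of G. Spectators stand on the left; an operation may
   also reorder wires, so this is no restriction in ppt_theory. *)
Inductive circuit (T : theory) (G : symmetry) (s : system) :
    forall t, (operator s -> operator t) -> Prop :=
| circuit_empty : circuit T G (fun X : operator s => X)
| circuit_operation r a b (F : operator s -> operator (r ++ a))
    (L : operator a -> operator b) :
    circuit T G F -> is_operation T L -> well_labelled (r ++ b) ->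
    circuit T G (fun X => extend L (F X))
| circuit_insertion t (F : operator s -> operator t) f :
    circuit T G F -> G t f -> circuit T G (fun X => f (F X)).

Definition weakly_nonphysical (T : theory) (G : symmetry) : Prop :=
  ~ physical T G /\
  forall s t (rho : operator s) (M : operator s -> operator t)
    (K : finType) (E : K -> operator t),
    well_labelled s -> is_state T rho -> circuit T G M ->
    is_measurement T E ->
    forall k, 0 <= \tr (E k *m M rho) <= 1.

Definition density s (rho : operator s) : Prop := psdmx rho /\ \tr rho = 1.

Definition ppt_effect s (E : operator s) : Prop :=
  E \is hermsymmx /\
  forall S : {pred nat}, psdmx (partial_transpose S E) /\
    psdmx (1%:M - partial_transpose S E).

Definition ppt_operation s t (L : operator s -> operator t) : Prop :=
  [/\ linear L, trace_preserving L &
    forall V : {pred nat}, completely_positive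
      (fun X => partial_transpose V (L (partial_transpose V X)))].

Definition ppt_theory : theory :=
  Theory density ppt_effect ppt_operation.

(* Complex conjugation acts on Hermitian operators as transposition; its
   partial action is taken to be the linear map partial_transpose. *)
Definition complex_conjugation : symmetry :=
  fun s f => exists S : {pred nat}, f = @partial_transpose S s.

End Operators.

Arguments complex_conjugation : clear implicits.
Arguments ppt_theory : clear implicits.

(* Main.v *)
(* Along a circuit one keeps a set S of labels such that Gamma_S of the current
   operator is positive semidefinite. Inserting Gamma_V replaces S by its
   symmetric difference with V. An operation L sends Gamma_S X to
   (Gamma_S o L o Gamma_S)(Gamma_S X), which is positive because
   Gamma_S o L o Gamma_S is completely positive, so S is unchanged. At the end
   Tr(E X) = Tr(Gamma_S(E) Gamma_S(X)) with both factors positive, and the same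
   holds for 1 - E. Conjugation is not physical since the transposition of a
   qubit maps the Bell state to a multiple of the swap, which is negative on
   |01> - |10>. *)

Require Import Defs.
From mathcomp Require Import all_boot all_order all_algebra.
From mathcomp Require Import complex reals.

Set Implicit Arguments.
Unset Strict Implicit.
Unset Printing Implicit Defensive.

Import Order.TTheory GRing.Theory Num.Theory.

Local Open Scope ring_scope.
Local Open Scope sesquilinear_scope.

(** * Positive semidefinite matrices *)

Lemma psdmx_mul_adjoint (C : numClosedFieldType) n (u : 'cV[C]_n) :
  psdmx (u *m u ^t*).
Proof.
move=> v; rewrite mulmxA -mulmxA.
have -> : v ^t* *m u = (u ^t* *m v) ^t*.
  by rewrite trmx_mul map_mxM trmxCK.
by rewrite mxE big_ord1 !mxE mulrC mul_conjC_ge0.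
Qed.

Lemma adjointB (C : numClosedFieldType) m n (A B : 'M[C]_(m, n)) :
  (A - B) ^t* = A ^t* - B ^t*.
Proof. by apply/matrixP => i j; rewrite !mxE rmorphB. Qed.

(** The right-hand side is the quadratic form of [A] at the difference of two basis vectors; with
    |01> and |10> it detects the negativity of the swap. *)
Lemma psdmx_delta_sub (C : numClosedFieldType) n (A : 'M[C]_n) (i j : 'I_n) :
  psdmx A -> 0 <= A i i + A j j - (A i j + A j i).
Proof.
move=> /(_ (delta_mx i 0 - delta_mx j 0)).
rewrite adjointB !trmx_delta !map_delta_mx mulmxBl mulmxBr !mulmxBl.
by rewrite -!rowE -!colE !mxE opprB addrACA [- A j i - _]addrC -opprD.
Qed.

Lemma psdmx_conj (C : numClosedFieldType) m n (A : 'M[C]_n) (P : 'M[C]_(m, n)) :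
  psdmx A -> psdmx (P *m A *m P ^t*).
Proof.
move=> A_ge0 v; have := A_ge0 (P ^t* *m v).
by rewrite trmx_mul map_mxM trmxCK !mulmxA.
Qed.

Lemma psdmx_diag_ge0 (C : numClosedFieldType) n (A : 'M[C]_n) i :
  psdmx A -> 0 <= A i i.
Proof.
move=> /(_ (delta_mx i 0)).
by rewrite trmx_delta map_delta_mx -rowE -colE !mxE.
Qed.

(** In an eigenbasis [P] of [A] the trace becomes a sum of eigenvalues of [A] times diagonal entries
    of [P B P^*]. The eigenvalues are themselves diagonal entries of [P A P^*], so positivity under
    congruence handles both factors. *)
Lemma psdmx_trace_mul_ge0 (C : numClosedFieldType) n (A B : 'M[C]_n) :
  A \is hermsymmx -> psdmx A -> psdmx B -> 0 <= \tr (A *m B).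
Proof.
move=> /hermitian_normalmx/orthomx_spectralP.
set P := spectralmx A; set d := spectral_diag A => A_eq A_ge0 B_ge0.
have P_unitary : P \is unitarymx by exact: spectral_unitarymx.
have P_unit : P \in unitmx by exact: unitarymx_unit.
have d_eq : diag_mx d = P *m A *m P ^t*.
  by rewrite A_eq -invmx_unitary // !mulmxA mulmxV // mul1mx mulmxK.
have -> : \tr (A *m B) = \tr (diag_mx d *m (P *m B *m P ^t*)).
  by rewrite A_eq -invmx_unitary // -!mulmxA mxtrace_mulC !mulmxA.
apply: sumr_ge0 => i _; rewrite mul_diag_mx mxE mulr_ge0 //.
  have := psdmx_diag_ge0 i (psdmx_conj P A_ge0).
  by rewrite -d_eq !mxE eqxx.
exact/psdmx_diag_ge0/psdmx_conj.
Qed.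

(** * Entries and indices in the product basis *)

Lemma entry_operator_of (C : numClosedFieldType) s (f : basis s -> basis s -> C)
  x y : entry (operator_of f) x y = f x y.
Proof. by rewrite /entry mxE !enum_rankK. Qed.

Lemma operatorP (C : numClosedFieldType) s (X Y : operator C s) :
  (forall x y, entry X x y = entry Y x y) <-> X = Y.
Proof.
split=> [XY | -> //]; apply/matrixP => i j.
by rewrite -(enum_valK i) -(enum_valK j); exact: XY.
Qed.

Lemma sum_basis (C : numClosedFieldType) s (F : 'I_#|basis s| -> C) :
  \sum_i F i = \sum_(x : basis s) F (enum_rank x).
Proof.
by rewrite (reindex (@enum_rank (basis s))) //; exists enum_val => x _;
  rewrite ?enum_rankK ?enum_valK.
Qed.

Lemma mxtrace_entry (C : numClosedFieldType) s (X : operator C s) :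
  \tr X = \sum_x entry X x x.
Proof. exact: sum_basis. Qed.

Lemma mxtrace_mul_entry (C : numClosedFieldType) s (X Y : operator C s) :
  \tr (X *m Y) = \sum_x \sum_y entry X x y * entry Y y x.
Proof.
rewrite mxtrace_entry; apply: eq_bigr => x _.
by rewrite /entry mxE sum_basis.
Qed.

Lemma pair_indexK r s (x : basis r) (y : basis s) :
  split_index (pair_index x y) = (x, y).
Proof.
by elim: r x => [|w r IH] /= [] // i x; rewrite IH.
Qed.

Lemma split_indexK r s (z : basis (r ++ s)) :
  pair_index (split_index z).1 (split_index z).2 = z.
Proof. by elim: r z => [|w r IH] //= [i z] /=; rewrite IH. Qed.

Lemma sum_basis_cat (C : numClosedFieldType) r s (F : basis (r ++ s) -> C) :
  \sum_z F z = \sum_x \sum_y F (pair_index x y).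
Proof.
rewrite pair_big (reindex (fun p => pair_index p.1 p.2)) //=.
by exists (@split_index r s) => [[x y] _ | z _];
  rewrite ?pair_indexK ?split_indexK.
Qed.

Lemma mix_index_id S s (x : basis s) : mix_index S x x = x.
Proof. by elim: s x => [|w s IH] //= [i x] /=; rewrite IH if_same. Qed.

Lemma mix_index_pred0 (S : {pred nat}) s (x y : basis s) :
  S =i pred0 -> mix_index S x y = x.
Proof.
by move=> S0; elim: s x y => [|w s IH] //= [i x] [j y] /=; rewrite IH S0.
Qed.

(** A coordinate exchanged by both [S] and [V] returns to its place, so only the symmetric
    difference remains. [U] is described by membership, because predicates with the same members
    need not be equal terms. *)
Lemma mix_index_mix (S V U : {pred nat}) s (x y : basis s) :
  (forall a, (a \in U) = (a \in S) (+) (a \in V)) ->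
  mix_index S (mix_index V x y) (mix_index V y x) = mix_index U x y.
Proof.
move=> UE; elim: s x y => [|w s IH] //= [i x] [j y] /=; rewrite IH UE.
by case: (_ \in S); case: (_ \in V).
Qed.

Lemma mix_index_pair S r s (x x' : basis r) (y y' : basis s) :
  mix_index S (pair_index x y) (pair_index x' y') =
  pair_index (mix_index S x x') (mix_index S y y').
Proof. by elim: r x x' => [|w r IH] //= [i x] [j x'] /=; rewrite IH. Qed.

Lemma mix_indexK S s (x y : basis s) :
  mix_index S (mix_index S x y) (mix_index S y x) = x.
Proof.
by rewrite (@mix_index_mix S S pred0) ?mix_index_pred0 // => a; rewrite addbb.
Qed.

Lemma split_index_mix S r s (z z' : basis (r ++ s)) :
  split_index (mix_index S z z') =
  (mix_index S (split_index z).1 (split_index z').1,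
   mix_index S (split_index z).2 (split_index z').2).
Proof.
rewrite -{1}(split_indexK z) -{1}(split_indexK z') mix_index_pair.
exact: pair_indexK.
Qed.

(** * Partial transposition, traces and extensions *)

Lemma partial_transpose_pred0 (C : numClosedFieldType) (S : {pred nat}) s
  (X : operator C s) : S =i pred0 -> partial_transpose S X = X.
Proof.
move=> S0; apply/operatorP => x y.
by rewrite entry_operator_of !mix_index_pred0.
Qed.

Lemma partial_transpose_comp (C : numClosedFieldType) (S V U : {pred nat}) s
  (X : operator C s) :
  (forall a, (a \in U) = (a \in S) (+) (a \in V)) ->
  partial_transpose S (partial_transpose V X) = partial_transpose U X.
Proof.
move=> UE; apply/operatorP => x y; rewrite !entry_operator_of.
(* The outer transposition acts first on the indices, so [S] and [V] appear in reverse order. *)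
by rewrite !(@mix_index_mix V S U) // => a; rewrite UE addbC.
Qed.

Lemma mxtrace_partial_transpose (C : numClosedFieldType) (S : {pred nat}) s
  (X : operator C s) : \tr (partial_transpose S X) = \tr X.
Proof.
rewrite !mxtrace_entry; apply: eq_bigr => x _.
by rewrite entry_operator_of mix_index_id.
Qed.

(** Exchanging the coordinates labelled in [S] between [x] and [y] is an involution on pairs, so it
    only permutes the terms of the double sum for the trace. *)
Lemma mxtrace_mul_partial_transpose (C : numClosedFieldType) (S : {pred nat}) s
  (X Y : operator C s) :
  \tr (partial_transpose S X *m partial_transpose S Y) = \tr (X *m Y).
Proof.
rewrite !mxtrace_mul_entry !pair_big /=.
rewrite [RHS](reindex_inj (h := fun p =>
  (mix_index S p.1 p.2, mix_index S p.2 p.1))) /=.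
  by apply: eq_bigr => p _; rewrite !entry_operator_of.
by apply: (can_inj (g := fun p =>
  (mix_index S p.1 p.2, mix_index S p.2 p.1))) => -[x y] /=;
  rewrite !mix_indexK.
Qed.

Lemma partial_transpose_hermsym (C : numClosedFieldType) (S : {pred nat}) s
  (X : operator C s) : X \is hermsymmx -> partial_transpose S X \is hermsymmx.
Proof.
move=> /is_hermitianmxP X_herm; apply/is_hermitianmxP/operatorP => x y.
rewrite expr0 scale1r /entry !mxE !enum_rankK /entry [X in LHS]X_herm.
by rewrite expr0 scale1r !mxE.
Qed.

Lemma hermsymmx_subr (C : numClosedFieldType) n (A : 'M[C]_n) :
  A \is hermsymmx -> 1%:M - A \is hermsymmx.
Proof.
move=> /is_hermitianmxP A_herm; apply/is_hermitianmxP.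
move: A_herm; rewrite expr0 !scale1r => A_herm.
by rewrite adjointB trmx1 map_mx1 -A_herm.
Qed.

(** The trace is a sum over the diagonal blocks <x| X |x>, and [L] preserves the trace of each. *)
Lemma mxtrace_extend (C : numClosedFieldType) r s t
  (L : operator C s -> operator C t) :
  trace_preserving L -> trace_preserving (@extend C r s t L).
Proof.
move=> L_tr X; rewrite !mxtrace_entry !sum_basis_cat; apply: eq_bigr => x _.
under eq_bigr do rewrite entry_operator_of pair_indexK /=.
rewrite -mxtrace_entry L_tr mxtrace_entry; apply: eq_bigr => y _.
by rewrite entry_operator_of.
Qed.

(** On the spectators [r] transposition merely permutes the blocks, which commutes with applying [L]
    blockwise; on the other wires it conjugates [L]. This exposes the map that is completely
    positive by definition of an operation. *)
Lemma partial_transpose_extend (C : numClosedFieldType) (S : {pred nat}) r s t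
  (L : operator C s -> operator C t) (X : operator C (r ++ s)) :
  partial_transpose S (extend L X) =
  extend (fun Y => partial_transpose S (L (partial_transpose S Y)))
    (partial_transpose S X).
Proof.
apply/operatorP => z z'; rewrite !entry_operator_of !split_index_mix /=.
rewrite [RHS]entry_operator_of; congr (entry (L _) _ _).
by apply/operatorP => y y'; rewrite !entry_operator_of !mix_index_pair !mix_indexK.
Qed.

(** * Invariants along a circuit *)

Lemma circuit_trace_preserving (C : numClosedFieldType) s t
  (M : operator C s -> operator C t) :
  circuit (ppt_theory C) (complex_conjugation C) M -> trace_preserving M.
Proof.
elim=> {t M} [//|r a b F L _ IH [_ L_tr _] _ X|t F f _ IH [S ->] X].
  by rewrite mxtrace_extend.
by rewrite mxtrace_partial_transpose.
Qed.

Lemma circuit_psdmx (C : numClosedFieldType) s t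
  (M : operator C s -> operator C t) (rho : operator C s) :
  circuit (ppt_theory C) (complex_conjugation C) M -> psdmx rho ->
  exists S : {pred nat}, psdmx (partial_transpose S (M rho)).
Proof.
move=> M_circ rho_ge0; elim: M_circ => {t M}.
- by exists xpred0; rewrite partial_transpose_pred0.
- move=> r a b F L _ [S F_ge0] [_ _ L_cp] _; exists S.
  by rewrite partial_transpose_extend; exact: L_cp.
- move=> t F f _ [S F_ge0] [V ->].
  exists (fun a => (a \in S) (+) (a \in V)).
  (* Adding [V] to the new set cancels it: the composite is transposition on the old [S]. *)
  rewrite (@partial_transpose_comp _ _ _ S) // => a.
  by rewrite [a \in fun _ => _]unfold_in -addbA addbb addbF.
Qed.

(** * Transposing one half of a Bell pair *)

Definition qubit : system := [:: @Wire 0 2 isT].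

(** The unnormalised vector |00> + |11>. *)
Definition bell_vector (C : numClosedFieldType) :
  'cV[C]_#|basis (qubit ++ qubit)| :=
  \col_i ((enum_val i).1 == (enum_val i).2.1)%:R.

Lemma partial_transpose_not_physical (C : numClosedFieldType) :
  ~ physical (ppt_theory C) (complex_conjugation C).
Proof.
move=> /(_ qubit (@partial_transpose C xpredT qubit) isT).
(* With [V] empty the condition is plain complete positivity of the transposition, tested with a
   second qubit as reference. *)
case=> [|_ _ /(_ pred0 qubit _ (psdmx_mul_adjoint (bell_vector C)))].
  by exists xpredT.
pose z01 : basis (qubit ++ qubit) := (ord0, (ord_max, tt)).
pose z10 : basis (qubit ++ qubit) := (ord_max, (ord0, tt)).
move=> /(psdmx_delta_sub (enum_rank z01) (enum_rank z10)).
rewrite !mxE !enum_rankK /partial_transpose /= !entry_operator_of /=.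
rewrite /entry !mxE !big_ord1 !mxE !enum_rankK /=.
(* The diagonal entries at |01> and |10> vanish and the off-diagonal ones equal 1, which leaves 0 <=
   -2. *)
by rewrite !mul0r conjC1 mulr1 add0r sub0r oppr_ge0 -mulr2n lern0.
Qed.

Theorem proposition6 (R : realType) :
  weakly_nonphysical (ppt_theory R[i]) (complex_conjugation R[i]) /\
  forall (s t : system) (rho : operator R[i] s)
    (M : operator R[i] s -> operator R[i] t)
    (K : finType) (E : K -> operator R[i] t),
    well_labelled s ->
    is_state (ppt_theory R[i]) rho ->
    circuit (ppt_theory R[i]) (complex_conjugation R[i]) M ->
    is_measurement (ppt_theory R[i]) E ->
    (forall k, 0 <= \tr (E k *m M rho) <= 1) /\
    \sum_k \tr (E k *m M rho) = 1.

Proof.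
have closed_circuit (s t : system) (rho : operator R[i] s)
    (M : operator R[i] s -> operator R[i] t)
    (K : finType) (E : K -> operator R[i] t) :
    is_state (ppt_theory R[i]) rho ->
    circuit (ppt_theory R[i]) (complex_conjugation R[i]) M ->
    is_measurement (ppt_theory R[i]) E ->
    (forall k, 0 <= \tr (E k *m M rho) <= 1) /\
    \sum_k \tr (E k *m M rho) = 1.
  move=> [rho_ge0 rho_tr] M_circ [E_effect E_sum].
  have M_tr : \tr (M rho) = 1.
    by rewrite (circuit_trace_preserving M_circ) rho_tr.
  split=> [k|]; last by rewrite -raddf_sum -mulmx_suml E_sum mul1mx.
  have [S M_ge0] := circuit_psdmx M_circ rho_ge0.
  have [E_herm /(_ S) [E_ge0 E_le1]] := E_effect k.
  have ES_herm := partial_transpose_hermsym S E_herm.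
  rewrite -(mxtrace_mul_partial_transpose S) psdmx_trace_mul_ge0 //=.
  (* The upper bound is positivity against the complementary effect, the transposed output still
     having trace 1. *)
  have := psdmx_trace_mul_ge0 (hermsymmx_subr ES_herm) E_le1 M_ge0.
  by rewrite mulmxBl mul1mx raddfB /= mxtrace_partial_transpose M_tr subr_ge0.
split; last by move=> s t rho M K E _; exact: closed_circuit.
split; first exact: partial_transpose_not_physical.
move=> s t rho M K E _ rho_state M_circ E_meas k.
by have [] := closed_circuit _ _ _ _ _ _ rho_state M_circ E_meas.
Qed.
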